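(* Let $u,v\in\mathcal{H}\setminus\Delta$, with $F,G$ the corresponding Carathéodory series, let $p\in\mathbb{Z}$, and let $L,M\in\Lambda$ be such that $(L^{*_p},M^{*_p})=(L,M)$. Then $uL=vM$ if and only if there exists $C\in\Lambda$ with $C^{*_p}=-C$ such that $FL=GM+C$.
   Context: $\Lambda=\mathbb{C}[z,z^{-1}]$ is the ring of complex Laurent polynomials and $\Lambda_0=\Lambda\setminus\{0\}$. For $H\in\Lambda$, $H_*(z)=\overline{H(1/\overline{z})}$ and, for $p\in\mathbb{Z}$, $H^{*_p}(z)=z^pH_*(z)$. $\Lambda'=\operatorname{Hom}(\Lambda,\mathbb{C})$. For $u\in\Lambda'$ and $L\in\Lambda$, the functional $uL\in\Lambda'$ is defined by $uL[f]=u[Lf]$. A functional $u\in\Lambda'$ with moments $\mu_n=u[z^n]$, $n\in\mathbb{Z}$, is hermitian if $\mu_{-n}=\overline{\mu_n}$ for all $n$; $\mathcal{H}$ denotes the set of hermitian functionals. $\Delta=\{u\in\mathcal{H} : \exists\, L\in\Lambda_0 \text{ such that } uL=0\}$. The Carathéodory series of $u\in\mathcal{H}$ is the formal power series $F(z)=\mu_0+2\sum_{n\ge1}\mu_{-n}z^n$. The identity $FL=GM+C$ is an identity of formal Laurent series with finitely many negative powers of $z$. *)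

(* Defs.v *)
From HB Require Import structures.
From mathcomp Require Import all_boot all_order all_algebra finmap.
From mathcomp Require Import complex reals monalg.
From mathcomp Require boolp.

Set Implicit Arguments.
Unset Strict Implicit.
Unset Printing Implicit Defensive.

Import Order.TTheory GRing.Theory Num.Theory.
Local Open Scope fset_scope.
Local Open Scope ring_scope.

Section LaurentPolynomials.
Context (K : comNzRingType).

(* The sum of the a_n z^n is the finitely supported function n |-> a_n on the
   integers.  monalg only provides a product on {malg K[M]} when the monoid M
   has no nontrivial unit, so the convolution product over int is set up here. *)
Definition laurent : Type := {malg K[int]}.
HB.instance Definition _ := GRing.Lmodule.copy laurent {malg K[int]}.

Implicit Types (L M N f : laurent) (m n p : int).

Definition lcoef L n : K := mcoeff n (L : {malg K[int]}).

Definition lmono (c : K) n : laurent := mkmalgU n c.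

Definition zpow n : laurent := lmono 1 n.

Definition lmul L M : laurent :=
  \sum_(m <- msupp L) \sum_(n <- msupp M) lmono (lcoef L m * lcoef M n) (m + n).

Lemma laurentP L M : (forall n, lcoef L n = lcoef M n) <-> L = M.
Proof. exact: malgP. Qed.

Lemma laurentE L : L = \sum_(n <- msupp L) lmono (lcoef L n) n.
Proof. exact: monalgE. Qed.

Lemma lcoef0 n : lcoef 0 n = 0. Proof. exact: mcoeff0. Qed.
Lemma lcoefD L M n : lcoef (L + M) n = lcoef L n + lcoef M n.
Proof. exact: mcoeffD. Qed.
Lemma lcoefZ a L n : lcoef (a *: L) n = a * lcoef L n.
Proof. exact: mcoeffZ. Qed.
Lemma lcoefN L n : lcoef (- L) n = - lcoef L n.
Proof. exact: mcoeffN. Qed.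
Lemma lcoef_mono c m n : lcoef (lmono c m) n = c *+ (m == n).
Proof. exact: mcoeffU. Qed.
Lemma lcoef_out L n : n \notin msupp L -> lcoef L n = 0.
Proof. exact: mcoeff_outdom. Qed.

Lemma lcoef_sum (I : Type) (s : seq I) (g : I -> laurent) n :
  lcoef (\sum_(i <- s) g i) n = \sum_(i <- s) lcoef (g i) n.
Proof.
by apply: (big_morph (lcoef^~ n)) => [x y|]; rewrite ?lcoefD ?lcoef0.
Qed.

Lemma lmonoD n c d : lmono (c + d) n = lmono c n + lmono d n.
Proof. exact: monalgUD. Qed.
Lemma lmono0 n : lmono 0 n = 0.
Proof. exact: monalgU0. Qed.

Section LinearSums.
Context (V : nmodType) (phi : int -> K -> V).
Hypotheses (phi0 : forall n, phi n 0 = 0)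
  (phiD : forall n, {morph phi n : c d / c + d}).

Lemma lsum_incl L (E : {fset int}) : msupp L `<=` E ->
  \sum_(n <- msupp L) phi n (lcoef L n) = \sum_(n <- E) phi n (lcoef L n).
Proof.
by move=> LE; apply: big_fset_incl => // n _ nL; rewrite lcoef_out.
Qed.

Lemma lsum0 : \sum_(n <- msupp (0 : laurent)) phi n (lcoef 0 n) = 0.
Proof. by rewrite msupp0 big_seq_fset0. Qed.

Lemma lsumD L M : \sum_(n <- msupp (L + M)) phi n (lcoef (L + M) n) =
  \sum_(n <- msupp L) phi n (lcoef L n) + \sum_(n <- msupp M) phi n (lcoef M n).
Proof.
rewrite (lsum_incl (msuppD_le L M)) (lsum_incl (fsubsetUl _ (msupp M))).
rewrite [in RHS](lsum_incl (fsubsetUr (msupp L) _)) -big_split /=.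
by apply: eq_bigr => n _; rewrite lcoefD phiD.
Qed.

Lemma lsum_mono c m :
  \sum_(n <- msupp (lmono c m)) phi n (lcoef (lmono c m) n) = phi m c.
Proof.
rewrite (lsum_incl (E := [fset m])) ?msuppU_le //.
by rewrite big_seq_fset1 lcoef_mono eqxx.
Qed.
End LinearSums.

Lemma lmul_mono c d m n : lmul (lmono c m) (lmono d n) = lmono (c * d) (m + n).
Proof.
pose phi i a := \sum_(j <- msupp (lmono d n)) lmono (a * lcoef (lmono d n) j) (i + j).
have phi0 i : phi i 0 = 0.
  by rewrite /phi big1 // => j _; rewrite mul0r lmono0.
rewrite [LHS](lsum_mono phi0) /phi.
by apply: (lsum_mono (phi := fun j b => lmono (c * b) (m + j))) => j;
  rewrite mulr0 lmono0.
Qed.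

Lemma lmul0l : left_zero 0 lmul.
Proof. by move=> M; rewrite /lmul msupp0 big_seq_fset0. Qed.

Lemma lmulDl : left_distributive lmul +%R.
Proof.
move=> L M N; rewrite /lmul.
apply: (lsumD (phi := fun i a => \sum_(j <- _) lmono (a * lcoef _ j) (i + j))).
- by move=> i; rewrite big1 // => j _; rewrite mul0r lmono0.
- move=> i a b; rewrite -big_split; apply: eq_bigr => j _.
  by rewrite mulrDl lmonoD.
Qed.

Lemma lmulC : commutative lmul.
Proof.
move=> L M; rewrite /lmul exchange_big; apply: eq_bigr => m _.
by apply: eq_bigr => n _; rewrite mulrC addrC.
Qed.

Lemma lmul0r : right_zero 0 lmul.
Proof. by move=> L; rewrite lmulC lmul0l. Qed.

Lemma lmulDr : right_distributive lmul +%R.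
Proof. by move=> L M N; rewrite lmulC lmulDl !(lmulC L). Qed.

Lemma lmul_suml (I : Type) (s : seq I) (g : I -> laurent) N :
  lmul (\sum_(i <- s) g i) N = \sum_(i <- s) lmul (g i) N.
Proof. exact: (big_morph (lmul^~ N) (fun _ _ => lmulDl _ _ _) (lmul0l _)). Qed.

Lemma lmul_sumr (I : Type) (s : seq I) (g : I -> laurent) N :
  lmul N (\sum_(i <- s) g i) = \sum_(i <- s) lmul N (g i).
Proof. by rewrite lmulC lmul_suml; apply: eq_bigr => i _; rewrite lmulC. Qed.

Lemma lmulA : associative lmul.
Proof.
move=> L M N; rewrite (laurentE L) !lmul_suml; apply: eq_bigr => i _.
rewrite (laurentE M) lmul_suml !lmul_sumr lmul_suml; apply: eq_bigr => j _.
rewrite (laurentE N) !lmul_sumr; apply: eq_bigr => k _.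
by rewrite !lmul_mono mulrA addrA.
Qed.

Lemma lmul1l : left_id (zpow 0) lmul.
Proof.
move=> L; rewrite {1}(laurentE L) lmul_sumr [RHS]laurentE.
by apply: eq_bigr => n _; rewrite lmul_mono mul1r add0r.
Qed.

Lemma laurent1_neq0 : zpow 0 != 0.
Proof.
apply/eqP => /laurentP /(_ 0) /eqP.
by rewrite lcoef_mono eqxx lcoef0 oner_eq0.
Qed.

HB.instance Definition _ := GRing.Zmodule_isComNzRing.Build laurent
  lmulA lmulC lmul1l lmulDl laurent1_neq0.

Lemma lmonoZ a c n : lmono (a * c) n = a *: lmono c n.
Proof. by apply/laurentP=> m; rewrite lcoefZ !lcoef_mono mulrnAr. Qed.

Lemma lmulE L M : L * M = lmul L M. Proof. by []. Qed.

Lemma lscaleAl a L M : a *: (L * M) = (a *: L) * M.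
Proof.
rewrite (laurentE L) !lmulE lmul_suml !scaler_sumr lmul_suml.
apply: eq_bigr => m _.
rewrite (laurentE M) !lmul_sumr scaler_sumr; apply: eq_bigr => n _.
by rewrite lmul_mono -!lmonoZ lmul_mono mulrA.
Qed.

HB.instance Definition _ := GRing.Lmodule_isLalgebra.Build K laurent lscaleAl.
HB.instance Definition _ := GRing.Lalgebra_isComAlgebra.Build K laurent.

Lemma zpow0 : zpow 0 = 1. Proof. by []. Qed.

Lemma lmonoM c d m n : lmono c m * lmono d n = lmono (c * d) (m + n).
Proof. exact: lmul_mono. Qed.

Lemma zpowD m n : zpow (m + n) = zpow m * zpow n.
Proof. by rewrite lmonoM mulr1. Qed.

Lemma lcoef_zpowM p L n : lcoef (zpow p * L) n = lcoef L (n - p).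
Proof.
rewrite lmulE {1}(laurentE L) [in RHS](laurentE L) lmul_sumr.
rewrite !lcoef_sum; apply: eq_bigr => i _.
by rewrite lmul_mono !lcoef_mono mul1r eq_sym [RHS]mulrb [LHS]mulrb
  addrC -subr_eq eq_sym.
Qed.

End LaurentPolynomials.

Section Star.
Context (K : numClosedFieldType).
Implicit Types (H : laurent K) (p n : int) (z : K).

Definition leval H z : K := \sum_(n <- msupp H) lcoef H n * z ^ n.

Definition lstar H : laurent K :=
  \sum_(n <- msupp H) lmono (lcoef H n)^* (- n).

Definition lstarp p H : laurent K := zpow K p * lstar H.

Lemma lcoef_star H n : lcoef (lstar H) n = (lcoef H (- n))^*.
Proof.
rewrite /lstar lcoef_sum [in RHS](laurentE H) lcoef_sum rmorph_sum.
by apply: eq_bigr => i _; rewrite !lcoef_mono rmorphMn eqr_oppLR.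
Qed.

Lemma lcoef_starp p H n : lcoef (lstarp p H) n = (lcoef H (p - n))^*.
Proof. by rewrite lcoef_zpowM lcoef_star opprB. Qed.

(* lstar is the operation H |-> H_* with H_*(z) = conj (H (1 / conj z)). *)
Lemma leval_star H z : leval (lstar H) z = (leval H (1 / z^*))^*.
Proof.
rewrite div1r /leval rmorph_sum.
set phi := fun (n : int) (c : K) => c * z ^ n.
have phi0 n : phi n 0 = 0 by rewrite /phi mul0r.
have phiD n : {morph phi n : c d / c + d} by move=> c d; rewrite /phi mulrDl.
pose ev (L : laurent K) := \sum_(n <- msupp L) phi n (lcoef L n).
rewrite -/(ev (lstar H)) /lstar.
rewrite (big_morph ev (fun _ _ => lsumD phi0 phiD _ _) (lsum0 phi)).
apply: eq_bigr => n _; rewrite /ev (lsum_mono phi0) /phi rmorphM /=.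
by congr (_ * _); rewrite fmorphXz fmorphV /= conjCK exprz_inv.
Qed.

End Star.

Section Functionals.
Context (K : comNzRingType).
Implicit Types (u : {scalar laurent K}) (L : laurent K).

Definition moment u (n : int) : K := u (zpow K n).

(* The functional uL. *)
Definition fmul u L (f : laurent K) : K := u (L * f).

Lemma fmul_is_scalar u L : scalar (fmul u L).
Proof. by move=> a f g; rewrite /fmul mulrDr -scalerAr linearP. Qed.

HB.instance Definition _ u L :=
  GRing.isLinear.Build K (laurent K) K *%R (fmul u L) (fmul_is_scalar u L).

End Functionals.

Section Hermitian.
Context (K : numClosedFieldType).
Implicit Types (u : {scalar laurent K}) (n : int).

Definition hermitian_functional u : Prop := forall n, moment u (- n) = (moment u n)^*.

Definition Delta u : Prop :=
  hermitian_functional u /\ exists2 L : laurent K, L != 0 & fmul u L =1 fun=> 0.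

End Hermitian.

Section LaurentSeries.
Context (K : comNzRingType).

Record lseries : Type := LSeries {
  scoef :> int -> K;
  scoef_bounded : exists N : int, forall n, n < N -> scoef n = 0 }.

HB.instance Definition _ := boolp.gen_eqMixin lseries.
HB.instance Definition _ := boolp.gen_choiceMixin lseries.

Implicit Types (F G : lseries) (L M C : laurent K) (m n : int).

Lemma lseriesP F G : (forall n, F n = G n) <-> F = G.
Proof.
split=> [|->//]; case: F G => [f fP] [g gP] /= /boolp.funext fg.
by subst g; congr LSeries; apply: boolp.Prop_irrelevance.
Qed.

Lemma szero_bounded : exists N : int, forall n, n < N -> 0 = 0 :> K.
Proof. by exists 0. Qed.
Definition szero : lseries := LSeries szero_bounded.

Lemma sadd_bounded F G : exists N : int, forall n, n < N -> F n + G n = 0.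
Proof.
case: (scoef_bounded F) (scoef_bounded G) => [N FN] [N' GN].
exists (Order.min N N') => n; rewrite lt_min => /andP[/FN-> /GN->].
by rewrite addr0.
Qed.
Definition sadd F G : lseries := LSeries (sadd_bounded F G).

Lemma sopp_bounded F : exists N : int, forall n, n < N -> - F n = 0.
Proof.
by case: (scoef_bounded F) => [N FN]; exists N => n /FN->; rewrite oppr0.
Qed.
Definition sopp F : lseries := LSeries (sopp_bounded F).

Fact saddA : associative sadd.
Proof. by move=> F G H; apply/lseriesP => n /=; rewrite addrA. Qed.
Fact saddC : commutative sadd.
Proof. by move=> F G; apply/lseriesP => n /=; rewrite addrC. Qed.
Fact sadd0 : left_id szero sadd.
Proof. by move=> F; apply/lseriesP => n /=; rewrite add0r. Qed.
Fact saddN : left_inverse szero sopp sadd.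
Proof. by move=> F; apply/lseriesP => n /=; rewrite addNr. Qed.

HB.instance Definition _ := GRing.isZmodule.Build lseries saddA saddC sadd0 saddN.

Lemma scoefD F G n : (F + G) n = F n + G n. Proof. by []. Qed.

Lemma msupp_bounded L : exists B : int, forall k, k \in msupp L -> B <= k.
Proof.
suff min_seq (s : seq int) : exists B : int, forall k, k \in s -> B <= k.
  exact: min_seq (enum_fset (msupp L)).
elim: s => [|k s [B Bs]]; first by exists 0.
exists (Order.min k B) => j; rewrite inE => /predU1P[->|/Bs js].
  by rewrite ge_min lexx.
by rewrite ge_min js orbT.
Qed.

Lemma smul_bounded L F : exists N : int, forall n, n < N ->
  \sum_(k <- msupp L) lcoef L k * F (n - k) = 0.
Proof.
case: (scoef_bounded F) => N FN.
have [B BL] := msupp_bounded L.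
exists (N + B) => n nNB; rewrite big_seq big1 // => k /BL Bk.
rewrite FN ?mulr0 // ltrBlDr; apply: lt_le_trans nNB _.
by rewrite lerD2l.
Qed.

(* The Cauchy product of a Laurent series F with a Laurent polynomial L; it
   makes the Laurent series a module over the ring of Laurent polynomials, so
   the product F L is written L *: F. *)
Definition smul L F : lseries := LSeries (smul_bounded L F).

Lemma smulDl F L M : smul (L + M) F = smul L F + smul M F.
Proof.
apply/lseriesP => n /=; apply: (lsumD (phi := fun k c => c * F (n - k))).
- by move=> k; rewrite mul0r.
- by move=> k c d; rewrite mulrDl.
Qed.

Lemma smul0l F : smul 0 F = 0.
Proof. by apply/lseriesP => n /=; rewrite msupp0 big_seq_fset0. Qed.

Lemma scoef_smul_mono c m F n : smul (lmono c m) F n = c * F (n - m).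
Proof.
by apply: (lsum_mono (phi := fun k c => c * F (n - k))) => k; rewrite mul0r.
Qed.

Lemma smul_suml (I : Type) (s : seq I) (g : I -> laurent K) F :
  smul (\sum_(i <- s) g i) F = \sum_(i <- s) smul (g i) F.
Proof. exact: (big_morph (smul^~ F) (smulDl F) (smul0l F)). Qed.

Lemma smulDr : right_distributive smul +%R.
Proof.
move=> L F G; apply/lseriesP => n /=; rewrite -big_split.
by apply: eq_bigr => k _; rewrite mulrDr.
Qed.

Lemma smul0r L : smul L 0 = 0.
Proof. by apply/lseriesP => n /=; rewrite big1 // => k _; rewrite mulr0. Qed.

Lemma smulA L M F : smul L (smul M F) = smul (L * M) F.
Proof.
rewrite (laurentE L) mulr_suml !smul_suml; apply: eq_bigr => i _.
rewrite (laurentE M) mulr_sumr !smul_suml.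
rewrite (big_morph (smul _) (smulDr _) (smul0r _)); apply: eq_bigr => j _.
apply/lseriesP => n.
by rewrite lmonoM !scoef_smul_mono mulrA opprD addrA.
Qed.

Lemma smul1 : left_id 1 smul.
Proof.
by move=> F; apply/lseriesP => n; rewrite scoef_smul_mono mul1r subr0.
Qed.

HB.instance Definition _ := GRing.Zmodule_isLmodule.Build (laurent K) lseries
  smulA smul1 smulDr smulDl.

Lemma scoefZ L F n :
  (L *: F) n = \sum_(k <- msupp L) lcoef L k * F (n - k).
Proof. by []. Qed.

Lemma lseries_of_bounded C : exists N : int, forall n, n < N -> lcoef C n = 0.
Proof.
have [B BC] := msupp_bounded C.
exists B => n nB; apply: lcoef_out; apply/negP => /BC.
by rewrite leNgt nB.
Qed.

Definition lseries_of C : lseries := LSeries (lseries_of_bounded C).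

Lemma lseries_ofM L M : lseries_of (L * M) = L *: lseries_of M.
Proof.
apply/lseriesP => n /=; rewrite {1}(laurentE L) mulr_suml lcoef_sum.
apply: eq_bigr => k _.
have -> : lmono (lcoef L k) k = lcoef L k *: zpow K k by rewrite -lmonoZ mulr1.
by rewrite -scalerAl lcoefZ lcoef_zpowM.
Qed.

Definition caratheodory_coef (u : {scalar laurent K}) n : K :=
  if n == 0 then moment u 0 else if 0 < n then 2 * moment u (- n) else 0.

Lemma caratheodory_bounded (u : {scalar laurent K}) :
  exists N : int, forall n, n < N -> caratheodory_coef u n = 0.
Proof.
by exists 0 => n n0; rewrite /caratheodory_coef lt_eqF // ltNge ltW.
Qed.

Definition caratheodory (u : {scalar laurent K}) : lseries :=
  LSeries (caratheodory_bounded u).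

End LaurentSeries.

(* Main.v *)
Require Import Defs.
From mathcomp Require Import all_boot all_order all_algebra finmap.
From mathcomp Require Import complex reals monalg.

Set Implicit Arguments.
Unset Strict Implicit.
Unset Printing Implicit Defensive.

Import Order.TTheory GRing.Theory Num.Theory.
Local Open Scope ring_scope.

(** Writing [F_n = mu_{-n} + sgn(n) mu_{-n}] splits the coefficients of [F L]
    as the moments [uL(z^{-n})] plus a remainder. As [mu] is hermitian and
    [L] is fixed by [*_p], the first part [x] satisfies [x_{p-n} = conj x_n] and
    the remainder [y_{p-n} = - conj y_n]. So the symmetric part of [FL - GM] is
    [uL - vM], which vanishes iff [FL - GM] is skew; a skew Laurent series
    has finitely many terms, because it is bounded below. *)

Section Convolution.
Context (K : numClosedFieldType).
Implicit Types (L M C : laurent K) (h : int -> K) (p n : int).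

(** The Cauchy product with a two-sided sequence: unlike the coefficients of a Laurent series, the
    moments of a functional need not vanish far to the left. *)
Definition lconv L h n : K := \sum_(k <- msupp L) lcoef L k * h (n - k).

(** The star sends exponent [k] to [p - k], and [(p - n) - (p - k) = -(n - k)]. The next two lemmas
    are the cases where the conjugate reflection of [h] is [h] or [- h]. *)
Lemma lconv_starp p L h n :
  lconv (lstarp p L) h (p - n) = (lconv L (fun m => (h (- m))^*) n)^*.
Proof.
pose phi (k : int) (c : K) := c * h (p - n - k).
have phi0 k : phi k 0 = 0 by rewrite /phi mul0r.
have phiD k : {morph phi k : c d / c + d} by move=> c d; rewrite /phi mulrDl.
(* Viewing the convolution as an additive map of the polynomial allows evaluating it monomial by
   monomial, without computing the support of [lstarp p L]. *)
pose ev (N : laurent K) := \sum_(k <- msupp N) phi k (lcoef N k).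
rewrite -[LHS]/(ev (lstarp p L)) /lstarp /lstar mulr_sumr.
rewrite (big_morph ev (fun _ _ => lsumD phi0 phiD _ _) (lsum0 phi)).
rewrite /lconv rmorph_sum; apply: eq_bigr => k _.
rewrite lmonoM mul1r /ev (lsum_mono phi0) /phi rmorphM /= conjCK.
by congr (_ * h _); rewrite opprB opprB addrC addrA subrK.
Qed.

Lemma lconv_herm p L h n : lstarp p L = L ->
  (forall m, h (- m) = (h m)^*) -> lconv L h (p - n) = (lconv L h n)^*.
Proof.
move=> LE hE; rewrite -{1}LE lconv_starp; congr (_^*).
by apply: eq_bigr => k _; rewrite hE conjCK.
Qed.

Lemma lconv_skew p L h n : lstarp p L = L ->
  (forall m, h (- m) = - (h m)^*) -> lconv L h (p - n) = - (lconv L h n)^*.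
Proof.
move=> LE hE; rewrite -{1}LE lconv_starp -rmorphN; congr (_^*).
rewrite /lconv -sumrN; apply: eq_bigr => k _.
by rewrite hE rmorphN /= conjCK mulrN.
Qed.

Lemma laurent_of_support (f : int -> K) (a b : int) :
  (forall n, n < a -> f n = 0) -> (forall n, b < n -> f n = 0) ->
  exists C : laurent K, forall n, lcoef C n = f n.
Proof.
(* The exponents run from [a] to [a + |b - a|]. If [b < a], then [f] is zero everywhere and the
   extra terms do no harm. *)
move=> fa fb; exists (\sum_(i < `|b - a|.+1) lmono (f (a + i%:Z)) (a + i%:Z)).
move=> n; rewrite lcoef_sum.
have [na|an] := ltP n a.
  rewrite fa // big1 // => i _; rewrite lcoef_mono.
  by case: eqP => // E; rewrite -E ltNge lerDl in na.
have nE : n = a + `|n - a|%N%:Z by rewrite gez0_abs ?subr_ge0 // [a + _]addrC subrK.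
have [lt_i|le_i] := ltnP `|n - a|%N `|b - a|.+1.
  rewrite (bigD1 (Ordinal lt_i)) //= -nE lcoef_mono eqxx big1 ?addr0 // => i ne_i.
  rewrite lcoef_mono; case: eqP => // E; case/negP: ne_i; apply/eqP/val_inj.
  by apply/eqP; rewrite /= -eqz_nat -(inj_eq (addrI a)) -nE E.
rewrite fb; last first.
  have: (`|b - a|%N%:Z < `|n - a|%N%:Z)%R by rewrite ltz_nat.
  rewrite [X in _ < X]gez0_abs ?subr_ge0 // => ba.
  by rewrite -(ltrD2r (- a)); apply: le_lt_trans ba; rewrite abszE ler_norm.
rewrite big1 // => i _; rewrite lcoef_mono; case: eqP => // E.
have := ltn_ord i; rewrite ltnNge => /negP[]; apply: leq_trans le_i _.
by rewrite -E [a + _]addrC addrK.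
Qed.

(** The reflection [n -> p - n] turns the lower bound [N] of the support into the upper bound
    [p - N]. *)
Lemma laurent_of_skew (F : lseries K) p :
  (forall n, F (p - n) = - (F n)^*) ->
  exists C : laurent K, lstarp p C = - C /\ F = lseries_of C.
Proof.
move=> Fskew; have [N FN] := scoef_bounded F.
have Fsym n : F n = - (F (p - n))^*.
  by rewrite -Fskew opprB [p + _]addrC subrK.
have [n n_gt|C CE] := @laurent_of_support F N (p - N) FN.
  by rewrite Fsym FN ?conjC0 ?oppr0 // ltrBlDr addrC -ltrBlDr.
exists C; split; last by apply/lseriesP => n /=; rewrite CE.
apply/laurentP => n; rewrite lcoef_starp lcoefN !CE Fskew.
by rewrite rmorphN /= conjCK.
Qed.

End Convolution.

Section Caratheodory.
Context (K : numClosedFieldType).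
Implicit Types (u v : {scalar laurent K}) (L M : laurent K) (p n : int).

Definition cara_rem u n : K := (sgz n)%:~R * moment u (- n).

Lemma cara_rem_skew u n : hermitian_functional u ->
  cara_rem u (- n) = - (cara_rem u n)^*.
Proof.
move=> hu; rewrite /cara_rem sgzN mulrNz mulNr hu rmorphM /=.
by rewrite rmorph_int.
Qed.

(** The weight [1 + sgn n] is 0, 1 or 2 for [n] negative, zero or positive, which matches the
    undoubled constant term. *)
Lemma caratheodoryE u n : caratheodory u n = moment u (- n) + cara_rem u n.
Proof.
rewrite /= /caratheodory_coef /cara_rem.
case: (ltrgtP n 0) => [n0|n0|->].
- by rewrite ltr0_sgz // mulrN1z mulNr mul1r subrr.
- by rewrite gtr0_sgz // mul1r mulr_natl.
- by rewrite sgz0 mul0r addr0 oppr0.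
Qed.

Lemma lconv_moment u L n :
  lconv L (fun m => moment u (- m)) n = fmul u L (zpow K (- n)).
Proof.
rewrite /fmul [in RHS](laurentE L) mulr_suml raddf_sum; apply: eq_bigr => k _.
rewrite lmonoM mulr1 -[lcoef L k in RHS]mulr1 lmonoZ [RHS]linearZ /=.
by rewrite opprB.
Qed.

Lemma scoef_mul_caratheodory u L n : (L *: caratheodory u) n =
  fmul u L (zpow K (- n)) + lconv L (cara_rem u) n.
Proof.
rewrite -lconv_moment scoefZ -big_split; apply: eq_bigr => k _ /=.
by rewrite -[caratheodory_coef _ _]/(caratheodory u (n - k)) caratheodoryE mulrDr.
Qed.

Lemma fmul_eq_moments u v L M :
  (forall n, fmul u L (zpow K (- n)) = fmul v M (zpow K (- n))) ->
  fmul u L =1 fmul v M.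
Proof.
move=> E f; rewrite (laurentE f) /fmul !mulr_sumr !raddf_sum.
apply: eq_bigr => k _; rewrite -[lcoef f k]mulr1 lmonoZ -!scalerAr [LHS]linearZ [RHS]linearZ /=.
by congr (_ * _); have := E (- k); rewrite opprK.
Qed.

Lemma fmul_eq_caratheodory u v p L M :
  hermitian_functional u -> hermitian_functional v ->
  lstarp p L = L -> lstarp p M = M ->
  fmul u L =1 fmul v M <->
  exists C : laurent K, lstarp p C = - C /\
    L *: caratheodory u = M *: caratheodory v + lseries_of C.
Proof.
move=> hu hv LE ME.
pose x n := fmul u L (zpow K (- n)) - fmul v M (zpow K (- n)).
pose y n := lconv L (cara_rem u) n - lconv M (cara_rem v) n.
have xE n : x (p - n) = (x n)^*.
  rewrite /x -!lconv_moment rmorphB /=.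
  by congr (_ - _); apply: lconv_herm => // m; rewrite -?hu -?hv.
have yE n : y (p - n) = - (y n)^*.
  rewrite /y rmorphB /= opprD.
  by congr (_ - _); apply: lconv_skew => // m; apply: cara_rem_skew.
have DE n : (L *: caratheodory u - M *: caratheodory v) n = x n + y n.
  rewrite -[LHS]/((L *: caratheodory u) n - (M *: caratheodory v) n).
  by rewrite !scoef_mul_caratheodory opprD addrACA.
split=> [uv|[C [CE FG]]].
  have [n|C [CE FG]] := @laurent_of_skew K (L *: caratheodory u - M *: caratheodory v) p.
    (* Equal functionals make [x] vanish, so the difference of the series is [y], which is skew. *)
    by rewrite !DE /x !uv !subrr !add0r yE.
  by exists C; split=> //; rewrite -FG addrC subrK.
have xyE n : x n = lcoef C n - y n.
  apply: (canRL (addrK _)); rewrite -DE FG.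
  by rewrite -/(lseries_of C n) [M *: _ + _]addrC addrK.
apply: fmul_eq_moments => n; apply/eqP; rewrite -subr_eq0 -/(x n).
have CpE : lcoef C (p - n) = - (lcoef C n)^*.
  by apply: (canRL opprK); rewrite -lcoefN -CE lcoef_starp opprB [p + _]addrC subrK.
(* Now [x = C - y] is skew as a difference of skew sequences, while [xE] makes it hermitian about
   [p]. Hence twice its conjugate is zero. *)
have: (x n)^* = - (x n)^*.
  by rewrite -xE [LHS]xyE CpE yE -opprD -rmorphB -xyE xE.
by move/eqP; rewrite -addr_eq0 -mulr2n mulrn_eq0 /= conjC_eq0.
Qed.

End Caratheodory.

Theorem corollary3p5 (R : realType) (u v : {scalar laurent R[i]})
    (hu : hermitian_functional u) (hu' : ~ Delta u)
    (hv : hermitian_functional v) (hv' : ~ Delta v)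
    (p : int) (L M : laurent R[i])
    (hLM : (lstarp p L, lstarp p M) = (L, M)) :
  fmul u L =1 fmul v M <->
  exists C : laurent R[i], lstarp p C = - C /\
    L *: caratheodory u = M *: caratheodory v + lseries_of C.
Proof.
by case: hLM => LE ME; apply: fmul_eq_caratheodory.
Qed.
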